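(* Let $1\le j\le n$ and $\epsilon\in\{0,1\}$. Define linear maps $\mathcal{E}_{j,0},\mathcal{E}_{j,1}:\mathcal{C}_{2n}\to\mathcal{C}_{2n}$ by $$\mathcal{E}_{j,0}(X)=(\hat a_j\hat a_j^\dagger)X(\hat a_j\hat a_j^\dagger),\qquad \mathcal{E}_{j,1}(X)=(\hat a_j^\dagger\hat a_j)X(\hat a_j^\dagger\hat a_j).$$ Then $\mathcal{E}_{j,\epsilon}$ is a Gaussian map; namely, for all $X\in\mathcal{C}_{2n}$, $$\mathcal{E}_{j,\epsilon}(X)(\theta)=\frac12\int\exp\left[S_{j,\epsilon}(\theta,\eta)+i\eta^T\mu\right]X(\mu)\,D\eta\,D\mu,$$ where $$S_{j,\epsilon}(\theta,\eta)=i(-1)^\epsilon\left(\theta_{2j-1}\theta_{2j}-\eta_{2j-1}\eta_{2j}\right)+i\sum_{\substack{1\le a\le 2n\\ a\ne 2j-1,\,2j}}\theta_a\eta_a .$$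
   Context: $\hat a_j,\hat a_j^\dagger$ ($j=1,\dots,n$) are fermionic annihilation and creation operators on the $2^n$-dimensional Fock space: $\{\hat a_j,\hat a_k\}=0$, $\{\hat a_j,\hat a_k^\dagger\}=\delta_{jk}$. Set $\hat c_{2j-1}=\hat a_j^\dagger+\hat a_j$ and $\hat c_{2j}=(-i)(\hat a_j^\dagger-\hat a_j)$; they satisfy $\hat c_a\hat c_b+\hat c_b\hat c_a=2\delta_{ab}\hat I$ and generate the Clifford algebra $\mathcal{C}_{2n}$, which is the algebra of all operators on Fock space. The Grassmann representation $X(\theta)$ of $X\in\mathcal{C}_{2n}$ is the image of $X$ under the linear isomorphism from $\mathcal{C}_{2n}$ to the complex Grassmann (exterior) algebra $\mathcal{G}_{2n}$ with anticommuting generators $\theta_1,\dots,\theta_{2n}$ sending $\hat I\mapsto1$ and $\hat c_{a_1}\cdots\hat c_{a_p}\mapsto\theta_{a_1}\cdots\theta_{a_p}$ for $a_1<\dots<a_p$; $X(\mu)$ is the same polynomial in anticommuting variables $\mu_1,\dots,\mu_{2n}$. The variables $\theta_a,\eta_a,\mu_a$ ($a=1,\dots,2n$) are $6n$ mutually anticommuting Grassmann generators. $\eta^T\mu=\sum_a\eta_a\mu_a$ and likewise for other forms; exponentials are finite Taylor series. Partial derivatives are left derivatives: $\partial_{\theta_a}1=0$, $\partial_{\theta_a}(\theta_bf)=\delta_{ab}f-\theta_b\partial_{\theta_a}f$. Berezin integration is $\int d\theta_a=\partial/\partial\theta_a$, $\int D\theta=\int d\theta_{2n}\cdots\int d\theta_1$,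 so $\int D\theta\,\theta_1\cdots\theta_{2n}=1$. A linear map $\mathcal{E}:\mathcal{C}_{2n}\to\mathcal{C}_{2n}$ is Gaussian iff $\mathcal{E}(X)(\theta)=C\int\exp[S(\theta,\eta)+i\eta^T\mu]X(\mu)\,D\eta\,D\mu$ for all $X$, where $C\in\mathbb{C}$ and $S(\theta,\eta)=\frac{i}{2}\theta^TA\theta+i\theta^TB\eta+\frac{i}{2}\eta^TD\eta$ for some complex $2n\times2n$ matrices $A,B,D$ ($A,D$ antisymmetric). *)

(* Defs.v *)
From HB Require Import structures.
From mathcomp Require Import all_boot all_order all_algebra.
From mathcomp Require Import ring.
Set Implicit Arguments.
Unset Strict Implicit.
Unset Printing Implicit Defensive.
Import Order.TTheory GRing.Theory Num.Theory.
Local Open Scope ring_scope.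

(* The exterior algebra on [N] generators, as an [algType]. An element is given
   by its coefficients: [f S] is the coefficient of the product, in increasing
   order, of the generators indexed by [S] (see [gmonom_prod]). *)
Definition grassmann (K : fieldType) (N : nat) : Type :=
  {ffun {set 'I_N} -> K^o}.

HB.instance Definition _ (K : fieldType) (N : nat) :=
  Vector.copy (grassmann K N) {ffun {set 'I_N} -> K^o}.

Section GrassmannAlgebra.
Variables (K : fieldType) (N : nat).
Implicit Types (S T U V W : {set 'I_N}) (f g h : grassmann K N).

(* Sign of the permutation sorting the monomial of [S] followed by that of [T],
   or 0 if they share a generator. *)
Definition gsign S T : K :=
  \prod_(a in S) \prod_(b in T)
    (if (a < b)%N then 1 else if a == b then 0 else -1).

Definition gmul f g : grassmann K N :=
  [ffun U => \sum_S \sum_(T | S :|: T == U) gsign S T * f S * g T].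

Definition gmonom S : grassmann K N := [ffun U => (U == S)%:R].

Lemma gsign0l T : gsign set0 T = 1.
Proof. by rewrite /gsign big_set0. Qed.

Lemma gsign0r S : gsign S set0 = 1.
Proof. by rewrite /gsign big1 // => i _; rewrite big_set0. Qed.

Lemma gsign_eq0 S T : ~~ [disjoint S & T] -> gsign S T = 0.
Proof.
rewrite -setI_eq0 => /set0Pn[a /setIP[aS aT]].
by rewrite /gsign (bigD1 a) //= (bigD1 a) //= ltnn eqxx !mul0r.
Qed.

Lemma disjointsUl S T U :
  [disjoint S :|: T & U] = [disjoint S & U] && [disjoint T & U].
Proof. by rewrite !disjoints_subset subUset. Qed.

Lemma gsignUl S T U : [disjoint S & T] ->
  gsign (S :|: T) U = gsign S U * gsign T U.
Proof.
move=> dST; rewrite /gsign -bigU //; apply: eq_bigl => a.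
by rewrite !inE.
Qed.

Lemma gsignUr S T U : [disjoint T & U] ->
  gsign S (T :|: U) = gsign S T * gsign S U.
Proof.
move=> dTU; rewrite /gsign -big_split /=; apply: eq_bigr => a _.
by rewrite -bigU //; apply: eq_bigl => b; rewrite !inE.
Qed.

Lemma gsignA S T U :
  gsign S T * gsign (S :|: T) U = gsign T U * gsign S (T :|: U).
Proof.
have [dST|ndST] := boolP [disjoint S & T]; last first.
  rewrite (gsign_eq0 ndST) mul0r (@gsign_eq0 S) ?mulr0 //.
  by apply: contra ndST; rewrite disjoint_sym disjointsUl disjoint_sym => /andP[].
have [dTU|ndTU] := boolP [disjoint T & U]; last first.
  rewrite (gsign_eq0 ndTU) mul0r (@gsign_eq0 (S :|: T)) ?mulr0 //.
  by apply: contra ndTU; rewrite disjointsUl => /andP[].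
by rewrite gsignUl // gsignUr //; ring.
Qed.

Lemma gmulE f g U :
  gmul f g U = \sum_S \sum_T (S :|: T == U)%:R * (gsign S T * f S * g T).
Proof.
rewrite ffunE; apply: eq_bigr => S _; rewrite big_mkcond; apply: eq_bigr => T _.
by case: eqP; rewrite ?mul1r ?mul0r.
Qed.

Lemma gmulA : associative gmul.
Proof.
move=> f g h; apply/ffunP=> U; rewrite !gmulE.
transitivity (\sum_S \sum_T \sum_V (S :|: T :|: V == U)%:R *
   (gsign S T * gsign (S :|: T) V * (f S * g T * h V))).
  apply: eq_bigr => S _.
  under eq_bigr => W _ do rewrite gmulE !mulr_sumr.
  rewrite exchange_big /=; apply: eq_bigr => T _.
  under eq_bigr => W _ do rewrite !mulr_sumr.
  rewrite exchange_big /=; apply: eq_bigr => V _.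
  rewrite (bigD1 (T :|: V)) //= big1 => [|W neW]; last first.
    by rewrite [_ == W]eq_sym (negPf neW) !(mul0r, mulr0).
  by rewrite eqxx mul1r addr0 setUA gsignA; ring.
symmetry.
rewrite exchange_big /=.
transitivity (\sum_V \sum_S \sum_T (S :|: T :|: V == U)%:R *
   (gsign S T * gsign (S :|: T) V * (f S * g T * h V))).
  apply: eq_bigr => V _.
  under eq_bigr => W _ do rewrite gmulE mulr_sumr mulr_suml mulr_sumr.
  rewrite exchange_big /=; apply: eq_bigr => S _.
  under eq_bigr => W _ do rewrite mulr_sumr mulr_suml mulr_sumr.
  rewrite exchange_big /=; apply: eq_bigr => T _.
  rewrite (bigD1 (S :|: T)) //= big1 => [|W neW]; last first.
    by rewrite [_ == W]eq_sym (negPf neW) !(mul0r, mulr0).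
  by rewrite eqxx mul1r addr0; ring.
rewrite exchange_big /=; apply: eq_bigr => S _.
by rewrite exchange_big.
Qed.

Lemma gmul1l : left_id (gmonom set0) gmul.
Proof.
move=> f; apply/ffunP=> U; rewrite ffunE (bigD1 set0) //=.
rewrite (bigD1 U) ?set0U //= !big1 ?addr0.
- by rewrite gsign0l ffunE eqxx !mul1r.
- by move=> S neS; rewrite big1 // => T _; rewrite ffunE (negPf neS) mulr0 mul0r.
- by move=> T /andP[/eqP<-]; rewrite set0U eqxx.
Qed.

Lemma gmul1r : right_id (gmonom set0) gmul.
Proof.
move=> f; apply/ffunP=> U; rewrite ffunE (bigD1 U) //=.
rewrite (bigD1 set0) ?setU0 //= !big1 ?addr0.
- by rewrite gsign0r ffunE eqxx mul1r mulr1.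
- move=> S neS; rewrite big1 // => T /eqP STU; rewrite ffunE.
  have [T0|_] := eqVneq T set0; last by rewrite mulr0.
  by move: neS; rewrite -STU T0 setU0 eqxx.
- by move=> T /andP[_ /negPf neT]; rewrite ffunE neT mulr0.
Qed.

Lemma gmulDl : left_distributive gmul +%R.
Proof.
move=> f g h; apply/ffunP=> U; rewrite [RHS]ffunE !gmulE -big_split /=.
apply: eq_bigr => S _; rewrite -big_split /=; apply: eq_bigr => T _.
by rewrite ffunE -mulrDr -mulrDl -mulrDr.
Qed.

Lemma gmulDr : right_distributive gmul +%R.
Proof.
move=> f g h; apply/ffunP=> U; rewrite [RHS]ffunE !gmulE -big_split /=.
apply: eq_bigr => S _; rewrite -big_split /=; apply: eq_bigr => T _.
by rewrite ffunE -!mulrDr.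
Qed.

Lemma gone_neq0 : gmonom set0 != 0.
Proof.
apply/eqP=> /ffunP/(_ set0); rewrite !ffunE eqxx => /eqP.
by rewrite oner_eq0.
Qed.

End GrassmannAlgebra.

HB.instance Definition _ (K : fieldType) (N : nat) :=
  GRing.Zmodule_isNzRing.Build (grassmann K N) (@gmulA K N) (@gmul1l K N)
    (@gmul1r K N) (@gmulDl K N) (@gmulDr K N) (@gone_neq0 K N).

Fact gscaleAl (K : fieldType) N (k : K) (f g : grassmann K N) :
  k *: (f * g) = k *: f * g.
Proof.
apply/ffunP=> U; rewrite ffunE !gmulE /GRing.scale /= mulr_sumr.
apply: eq_bigr => S _; rewrite mulr_sumr; apply: eq_bigr => T _.
by rewrite ffunE /GRing.scale /=; ring.
Qed.

HB.instance Definition _ (K : fieldType) (N : nat) :=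
  GRing.Lmodule_isLalgebra.Build K (grassmann K N) (@gscaleAl K N).

Fact gscaleAr (K : fieldType) N (k : K) (f g : grassmann K N) :
  k *: (f * g) = f * (k *: g).
Proof.
apply/ffunP=> U; rewrite ffunE !gmulE /GRing.scale /= mulr_sumr.
apply: eq_bigr => S _; rewrite mulr_sumr; apply: eq_bigr => T _.
by rewrite ffunE /GRing.scale /=; ring.
Qed.

HB.instance Definition _ (K : fieldType) (N : nat) :=
  GRing.Lalgebra_isAlgebra.Build K (grassmann K N) (@gscaleAr K N).

Section GrassmannCalculus.
Variables (K : fieldType) (N : nat).
Implicit Types (a b : 'I_N) (S T U : {set 'I_N}) (f g : grassmann K N).

Definition gvar a : grassmann K N := gmonom K [set a].

(* Removing [a] from a monomial costs the sign of moving [a] to its front. *)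
Definition gderiv a f : grassmann K N :=
  [ffun U : {set 'I_N} => if a \in U then 0 else gsign K [set a] U * f (a |: U)].

(* The full exponential series when [f] is nilpotent, i.e., has no constant
   term: then [f ^+ k = 0] for [N < k]. *)
Definition gexp f : grassmann K N := \sum_(k < N.+1) k`!%:R^-1 *: f ^+ k.

(* [\int d(v_(m-1)) ... \int d(v_0)]: the derivative in [v_0] acts first. *)
Definition berezin m (v : 'I_m -> 'I_N) f : grassmann K N :=
  foldl (fun g i => gderiv (v i) g) f (enum 'I_m).

Lemma gvarM a f U :
  (gvar a * f) U = if a \in U then gsign K [set a] (U :\ a) * f (U :\ a) else 0.
Proof.
rewrite [LHS]gmulE (bigD1 [set a]) //= [X in _ + X]big1 ?addr0; last first.
  by move=> S neS; rewrite big1 // => T _; rewrite ffunE (negPf neS) mulr0 mul0r mulr0.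
have [aU|naU] := boolP (a \in U); last first.
  rewrite big1 // => T _; case: eqP; last by rewrite mul0r.
  by move=> defU; rewrite -defU !inE eqxx in naU.
rewrite (bigD1 (U :\ a)) //= setD1K // eqxx [gvar a _]ffunE eqxx mul1r mulr1.
rewrite big1 ?addr0 // => T neT; case: eqP; last by rewrite mul0r.
move=> defU; rewrite (@gsign_eq0 _ _ [set a]) ?mul0r ?mulr0 //.
rewrite disjoints1 negbK; apply: contraR neT => naT.
by rewrite -defU setU1K.
Qed.

Lemma gsign1_sqr a U : a \notin U -> gsign K [set a] U * gsign K [set a] U = 1.
Proof.
move=> naU; rewrite /gsign !big_set1 -big_split /= big1 // => b bU.
case: ifP => _; first by rewrite mulr1.
by case: eqP => [ab|_]; [rewrite ab bU in naU | rewrite mulrNN mulr1].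
Qed.

Lemma gsign1U a b U : b \notin U ->
  gsign K [set a] (b |: U) = gsign K [set a] [set b] * gsign K [set a] U.
Proof. by move=> nbU; rewrite gsignUr // disjoints1. Qed.

Lemma gsign1C a b : a != b ->
  gsign K [set a] [set b] = - gsign K [set b] [set a].
Proof.
move=> neab; rewrite /gsign !big_set1 (negPf neab) eq_sym (negPf neab).
by case: ltngtP => [_|_|/val_inj eqab]; rewrite ?opprK // eqab eqxx in neab *.
Qed.

Lemma gderiv1 a : gderiv a 1 = 0.
Proof.
apply/ffunP=> U; rewrite !ffunE; case: ifP => // aU.
have [aU0|_] := eqVneq (a |: U) set0; last by rewrite mulr0.
by have := setU11 a U; rewrite aU0 inE.
Qed.

Lemma gderiv_gvarM a b f :
  gderiv a (gvar b * f) = (a == b)%:R *: f - gvar b * gderiv a f.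
Proof.
apply/ffunP=> U; rewrite ffunE [RHS]ffunE [X in _ = X + _]ffunE.
rewrite [X in _ = _ + X]ffunE !gvarM /GRing.scale /=.
have [<-|neab] := eqVneq a b.
  rewrite mul1r setU11; have [aU|naU] := boolP (a \in U).
    by rewrite ffunE setD11 setD1K // mulrA gsign1_sqr ?setD11 // mul1r subrr.
  by rewrite setU1K // mulrA gsign1_sqr // mul1r subr0.
rewrite mul0r add0r !inE eq_sym (negPf neab) /=.
have [aU|naU] := boolP (a \in U).
  by case: ifP; rewrite ?oppr0 // ffunE !inE neab aU mulr0 oppr0.
have [bU|nbU] := boolP (b \in U); last by rewrite mulr0 oppr0.
rewrite ffunE !inE (negPf naU) andbF.
have -> : (a |: U) :\ b = a |: (U :\ b).
  by apply/setP=> x; rewrite !inE; have [->|] := eqVneq x b; rewrite // eq_sym (negPf neab).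
rewrite gsign1U ?inE ?(negPf naU) ?andbF // gsign1C 1?eq_sym //.
rewrite -[in gsign K [set a] U](setD1K bU) gsign1U ?setD11 //.
have : gsign K [set a] [set b] * gsign K [set a] [set b] = 1.
  by apply: gsign1_sqr; rewrite inE.
set s := gsign K [set a] [set b] => s2.
transitivity (- (s * s) * gsign K [set b] (U :\ b) * gsign K [set a] (U :\ b) * f (a |: U :\ b)).
  by ring.
by rewrite s2; ring.
Qed.

Lemma gmonomM S T :
  gmonom K S * gmonom K T = gsign K S T *: gmonom K (S :|: T).
Proof.
apply/ffunP=> U; rewrite [LHS]gmulE [RHS]ffunE /GRing.scale /=.
rewrite (bigD1 S) //= [X in _ + X]big1 ?addr0; last first.
  by move=> V neV; rewrite big1 // => W _; rewrite ffunE (negPf neV) mulr0 mul0r mulr0.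
rewrite (bigD1 T) //= [X in _ + X]big1 ?addr0; last first.
  by move=> W neW; rewrite [gmonom K T W]ffunE (negPf neW) !mulr0.
by rewrite !ffunE !eqxx !mulr1 mulrC [U == _]eq_sym.
Qed.

Lemma gvar_sqr a : gvar a * gvar a = 0.
Proof. by rewrite gmonomM gsign_eq0 ?scale0r // disjoints1 inE eqxx. Qed.

Lemma gvar_anticomm a b : gvar a * gvar b = - (gvar b * gvar a).
Proof.
have [<-|neab] := eqVneq a b; first by rewrite gvar_sqr oppr0.
by rewrite !gmonomM gsign1C // scaleNr setUC.
Qed.

Lemma gmonom_prod S : gmonom K S = \prod_(a in S) gvar a.
Proof.
pose lt_ord (a b : 'I_N) := (a < b)%N.
have lt_tr : transitive lt_ord by move=> b a c; apply: ltn_trans.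
have Ssorted : sorted lt_ord (enum S).
  rewrite {1}/enum_mem sorted_filter // -enumT.
  by have := iota_ltn_sorted 0 N; rewrite -val_enum_ord sorted_map.
rewrite -big_filter; have -> : [seq a <- index_enum 'I_N | a \in S] = enum S.
  by rewrite [index_enum _]unlock.
rewrite -[in LHS](set_enum S).
elim: (enum S) Ssorted => [|a s IHs] /= sS; first by rewrite big_nil set_nil.
rewrite big_cons -IHs ?(path_sorted sS) // gmonomM set_cons.
suff -> : gsign K [set a] [set b in s] = 1 by rewrite scale1r.
rewrite /gsign big_set1 big1 // => b; rewrite inE => bs.
by have := allP (order_path_min lt_tr sS) b bs; rewrite /lt_ord /= => ->.
Qed.

End GrassmannCalculus.

Section FermionicModes.
Local Open Scope sesquilinear_scope.
Variables (C : numClosedFieldType) (n : nat).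

(* Anticommutation relations on a Fock space identified with [C^(2^n)] by an
   orthonormal basis, so that the adjoint is the conjugate transpose. *)
Definition fermionic (a : 'I_n -> 'M[C]_(2 ^ n)) : Prop :=
  forall j k,
    a j *m a k + a k *m a j = 0 /\
    a j *m (a k)^t* + (a k)^t* *m a j = (j == k)%:R%:M.

Fact mode_subproof (k : 'I_n.*2) : (k./2 < n)%N.
Proof. by rewrite ltn_half_double. Qed.

Fact ord_fst_subproof (j : 'I_n) : (j.*2 < n.*2)%N.
Proof. by rewrite ltn_double. Qed.

Fact ord_snd_subproof (j : 'I_n) : (j.*2.+1 < n.*2)%N.
Proof. by rewrite ltn_Sdouble. Qed.

(* Indices start at 0: the one-based pair [2j - 1, 2j] attached to mode [j] is
   here [2j, 2j + 1], and [k] belongs to mode [k./2]. *)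
Definition mode (k : 'I_n.*2) : 'I_n := Ordinal (mode_subproof k).
Definition ord_fst (j : 'I_n) : 'I_n.*2 := Ordinal (ord_fst_subproof j).
Definition ord_snd (j : 'I_n) : 'I_n.*2 := Ordinal (ord_snd_subproof j).

Variable a : 'I_n -> 'M[C]_(2 ^ n).

Definition majorana (k : 'I_n.*2) : 'M[C]_(2 ^ n) :=
  let b := a (mode k) in
  if odd k then (- 'i) *: (b^t* - b) else b^t* + b.

Lemma majorana_fst j : majorana (ord_fst j) = (a j)^t* + a j.
Proof.
rewrite /majorana /= odd_double; congr (_^t* + _); congr a; apply: val_inj;
by rewrite /= doubleK.
Qed.

Lemma majorana_snd j : majorana (ord_snd j) = (- 'i) *: ((a j)^t* - a j).
Proof.
rewrite /majorana /= odd_double /=; congr (_ *: (_^t* - _)); congr a;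
by apply: val_inj; rewrite /= uphalf_double.
Qed.

(* Products run in increasing order of the indices. *)
Definition clifford_of_grassmann (f : grassmann C n.*2) : 'M[C]_(2 ^ n) :=
  \sum_(S : {set 'I_n.*2}) f S *: \prod_(k in S) majorana k.

(* If [fermionic a], the ordered products of Majorana operators form a basis of
   the operators, so that [clifford_of_grassmann] is bijective and [^-1%VF] is
   its two-sided inverse. *)
Definition grassmann_rep (X : 'M[C]_(2 ^ n)) : grassmann C n.*2 :=
  ((linfun clifford_of_grassmann)^-1)%VF X.

Local Notation G := (grassmann C (n.*2 + n.*2 + n.*2)).

Definition theta_ord (k : 'I_n.*2) := lshift n.*2 (lshift n.*2 k).
Definition eta_ord (k : 'I_n.*2) := lshift n.*2 (rshift n.*2 k).
Definition mu_ord (k : 'I_n.*2) := rshift (n.*2 + n.*2) k.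

Definition theta k : G := gvar C (theta_ord k).
Definition eta k : G := gvar C (eta_ord k).
Definition mu k : G := gvar C (mu_ord k).

Definition gsubst (v : 'I_n.*2 -> G) (f : grassmann C n.*2) : G :=
  \sum_(S : {set 'I_n.*2}) f S *: \prod_(k in S) v k.

(* [\int exp(S + i eta^T mu) X(mu) D eta D mu]. Both measures have an even
   number of factors, so their relative order is immaterial. *)
Definition gaussian_integral (S : G) (X : 'M[C]_(2 ^ n)) : G :=
  berezin eta_ord (berezin mu_ord
    (gexp (S + 'i *: \sum_k eta k * mu k) * gsubst mu (grassmann_rep X))).

Definition quadratic_action (A B D : 'M[C]_(n.*2)) : G :=
  ('i / 2) *: (\sum_k \sum_l A k l *: (theta k * theta l))
  + 'i *: (\sum_k \sum_l B k l *: (theta k * eta l))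
  + ('i / 2) *: (\sum_k \sum_l D k l *: (eta k * eta l)).

Definition gaussian_map (E : 'M[C]_(2 ^ n) -> 'M[C]_(2 ^ n)) : Prop :=
  linear E /\
  exists (c : C) (A B D : 'M[C]_(n.*2)),
    [/\ A^T = - A, D^T = - D &
      forall X, gsubst theta (grassmann_rep (E X))
                = c *: gaussian_integral (quadratic_action A B D) X].

Definition occupation_proj (j : 'I_n) (eps : bool) : 'M[C]_(2 ^ n) :=
  if eps then (a j)^t* *m a j else a j *m (a j)^t*.

Definition occupation_map (j : 'I_n) (eps : bool) (X : 'M[C]_(2 ^ n)) :
    'M[C]_(2 ^ n) :=
  occupation_proj j eps *m X *m occupation_proj j eps.

End FermionicModes.
Arguments theta {C n} k.
Arguments eta {C n} k.
Arguments mu {C n} k.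

(* Main.v *)
From HB Require Import structures.
Require Import Defs.
From mathcomp Require Import all_boot all_order all_algebra.
From mathcomp Require Import reals complex.
Set Implicit Arguments.
Unset Strict Implicit.
Unset Printing Implicit Defensive.
Import Order.TTheory GRing.Theory Num.Theory.
Local Open Scope ring_scope.

(** Both sides are linear in [X], so it suffices to compare them on the Majorana
    monomial [c_S], and both factor over the modes. With [s = (-1)^eps], the
    projection is [P = (1 + i s c_p c_q) / 2], where [p, q] are the two indices of
    mode [j]. It commutes with the factors of [c_S] in the other modes, and at
    mode [j] it gives [P P = P], [P c_p P = P c_q P = 0] and
    [P c_p c_q P = - i s P]. On the integral side, the exponent is a sum of
    commuting quadratic terms of square zero, so its exponential is the product of
    the factors [1 + z]; a pair of derivatives passes through every factor that
    does not involve its two variables, so the integral is the ordered product of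
    one integral per mode. Away from [j] that integral is a Fourier transform
    followed by its inverse and turns [mu] into [theta]; at [j] it gives
    [1 + i s theta_p theta_q] times [1], [0], [0] or [- i s], the same weights as
    the projection. That Majorana monomials form a basis follows from trace
    orthogonality and a dimension count. *)

(** * Products over modes *)

Lemma big_enumT (R : Type) (idx : R) (op : R -> R -> R) (I : finType)
    (F : I -> R) :
  \big[op/idx]_i F i = \big[op/idx]_(i <- enum I) F i.
Proof. by rewrite enumT [index_enum _]unlock. Qed.

Section Modes.
Variable n : nat.

Lemma enum_double :
  enum 'I_n.*2 = flatten [seq [:: ord_fst m; ord_snd m] | m <- enum 'I_n].
Proof.
apply: (inj_map val_inj); rewrite val_enum_ord map_flatten -map_comp.
rewrite (@eq_map _ _ _ (fun m : 'I_n => [:: m.*2; m.*2.+1])) //.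
rewrite (map_comp (fun m => [:: m.*2; m.*2.+1]) val) val_enum_ord.
(* The starting points [0.*2] and [0] of the two [iota] lists are generalised together, so that
   induction on the length applies. *)
rewrite -[0%N in LHS]/(0.*2); elim: n 0%N => //= m IHm k.
by rewrite -IHm doubleS.
Qed.

Lemma prod_modes (A : pzSemiRingType) (F : 'I_n.*2 -> A) :
  \prod_k F k = \prod_(m < n) (F (ord_fst m) * F (ord_snd m)).
Proof.
rewrite !big_enumT enum_double big_flatten big_map.
by apply: eq_bigr => m _; rewrite big_cons big_seq1.
Qed.

Lemma sum_modes (A : nmodType) (F : 'I_n.*2 -> A) :
  \sum_k F k = \sum_(m < n) (F (ord_fst m) + F (ord_snd m)).
Proof.
rewrite !big_enumT enum_double big_flatten big_map.
by apply: eq_bigr => m _; rewrite big_cons big_seq1.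
Qed.

Lemma eq_ord_fst (i k : 'I_n) : (ord_fst i == ord_fst k) = (i == k).
Proof. by rewrite -!val_eqE /= (inj_eq double_inj). Qed.

Lemma eq_ord_snd (i k : 'I_n) : (ord_snd i == ord_snd k) = (i == k).
Proof. by rewrite -!val_eqE /= eqSS (inj_eq double_inj). Qed.

Lemma eq_ord_fst_snd (i k : 'I_n) : (ord_fst i == ord_snd k) = false.
Proof.
by apply/negP => /eqP/(congr1 (fun z : 'I_n.*2 => odd z)); rewrite /= !odd_double.
Qed.

Lemma eq_ord_snd_fst (i k : 'I_n) : (ord_snd i == ord_fst k) = false.
Proof. by rewrite eq_sym eq_ord_fst_snd. Qed.

Definition eq_ord_mode :=
  (eq_ord_fst, eq_ord_snd, eq_ord_fst_snd, eq_ord_snd_fst).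

(** The part of an ordered monomial lying in one mode. The two indices of a mode are consecutive, so
    an increasing product splits into these parts without reordering, even in a non-commutative
    ring. *)
Definition mode_prod (A : pzSemiRingType) (v : 'I_n.*2 -> A)
    (S : {set 'I_n.*2}) (m : 'I_n) : A :=
  (if ord_fst m \in S then v (ord_fst m) else 1)
  * (if ord_snd m \in S then v (ord_snd m) else 1).

Lemma prod_mode_prod (A : pzSemiRingType) (v : 'I_n.*2 -> A) (S : {set 'I_n.*2}) :
  \prod_(k in S) v k = \prod_(m < n) mode_prod v S m.
Proof. by rewrite big_mkcond prod_modes. Qed.

End Modes.

(** * Truncated exponentials *)

Section Exponential.
Variables (K : numFieldType) (A : algType K).
Implicit Types (x y : A) (s : seq A).

(** Since [x] squares to zero and commutes with [y], only the binomial terms of degree at most one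
    in [x] survive. *)
Lemma exprDn_sqr0 x y k : x * x = 0 -> GRing.comm x y ->
  (x + y) ^+ k.+1 = y ^+ k.+1 + (x * y ^+ k) *+ k.+1.
Proof.
move=> x2 cxy; elim: k => [|k IHk].
  by rewrite !expr1 expr0 mulr1 addrC mulr1n.
rewrite exprS IHk mulrDl !mulrDr !mulrnAr (mulrA x x) x2 mul0r mul0rn addr0.
rewrite (mulrA y x) -cxy -(mulrA x y) -exprS -exprS addrC -addrA.
by congr (_ + _); rewrite [RHS]mulrS addrC.
Qed.

(** The series of [gexp] with its truncation degree as a free parameter, so that an induction can
    lower it. *)
Definition exp_trunc M y : A := \sum_(k < M.+1) k`!%:R^-1 *: y ^+ k.

(** A truncated form of $e^{x+y} = (1 + x)e^y$: the factor [x] uses up one degree, hence the lower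
    truncation in the second term. *)
Lemma exp_truncD_sqr0 M x y : x * x = 0 -> GRing.comm x y ->
  exp_trunc M.+1 (x + y) = exp_trunc M.+1 y + x * exp_trunc M y.
Proof.
move=> x2 cxy; rewrite /exp_trunc big_ord_recl [in RHS]big_ord_recl /=.
rewrite !expr0 -addrA; congr (_ + _).
rewrite mulr_sumr -big_split /=; apply: eq_bigr => k _.
rewrite exprDn_sqr0 // scalerDr; congr (_ + _).
rewrite -scalerAr -scaler_nat scalerA; congr (_ *: _).
rewrite factS natrM invfM mulrAC mulVf ?mul1r //.
by rewrite pnatr_eq0.
Qed.

(* The truncation is harmless: each factor occurs at most once in a nonzero
   product, so powers beyond [size s] vanish. *)
Lemma exp_trunc_sum M s : (forall x, x \in s -> x * x = 0) ->
    (forall x y, x \in s -> y \in s -> GRing.comm x y) -> (size s <= M)%N ->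
  exp_trunc M (\sum_(x <- s) x) = \prod_(x <- s) (1 + x).
Proof.
elim: s M => [|x s IHs] M s2 cs.
  rewrite !big_nil /exp_trunc big_ord_recl big1 => [|k _]; last first.
    by rewrite expr0n /= scaler0.
  by rewrite fact0 invr1 expr0 scale1r addr0.
have s2' y : y \in s -> y * y = 0 by move=> ys; rewrite s2 ?inE ?ys ?orbT.
have cs' y z : y \in s -> z \in s -> GRing.comm y z.
  by move=> ys zs; apply: cs; rewrite inE ?ys ?zs orbT.
case: M => // M /= sM; rewrite !big_cons exp_truncD_sqr0; last 2 first.
- by rewrite s2 ?mem_head.
- rewrite big_seq; apply: commr_sum => y ys.
  by apply: cs; rewrite inE ?eqxx ?ys ?orbT.
by rewrite !IHs ?(ltnW sM) // mulrDl mul1r.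
Qed.

End Exponential.

(** * Berezin integrals of mode-wise products *)

Section Calculus.
Variables (K : fieldType) (N : nat).
Local Notation G := (grassmann K N).
Implicit Types (a b c x : 'I_N) (S T : {set 'I_N}) (f g h u w : G).

Fact gderiv_is_linear a : linear (@gderiv K N a).
Proof.
move=> k f g; apply/ffunP=> U; rewrite !ffunE /GRing.scale /=.
by case: ifP => _; rewrite ?mulr0 ?addr0 // mulrDr mulrCA.
Qed.
HB.instance Definition _ a :=
  GRing.isLinear.Build K G G *:%R (@gderiv K N a) (gderiv_is_linear a).

Lemma grassmann_gmonom f : f = \sum_S f S *: gmonom K S.
Proof.
apply/ffunP=> U; rewrite sum_ffunE (bigD1 U) //= [X in _ + X]big1 => [|S neS].
  by rewrite addr0 !ffunE eqxx /GRing.scale /= mulr1.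
by rewrite !ffunE eq_sym (negPf neS) /GRing.scale /= mulr0.
Qed.

Lemma gmonom_ind (P : G -> Prop) :
    P 0 -> (forall k S g, P g -> P (k *: gmonom K S + g)) -> forall f, P f.
Proof.
move=> P0 PD f; rewrite [f]grassmann_gmonom.
by elim/big_rec: _ => // S g _; apply: PD.
Qed.

(** Induction on words in the generators. It extends rules known for a generator on the left to
    arbitrary left factors. *)
Lemma gvarM_ind (P : G -> Prop) :
    P 1 -> (forall k f g, P f -> P g -> P (k *: f + g)) ->
    (forall b f, P f -> P (gvar K b * f)) -> forall f, P f.
Proof.
move=> P1 PD PM; elim/gmonom_ind => [|k S g Pg].
  (* Zero is [-1 *: 1 + 1], hence an instance of [PD]. *)
  by rewrite -(addNr 1) -scaleN1r; apply: PD.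
apply: PD => //; rewrite gmonom_prod.
by elim/big_rec: _ => // b h _; apply: PM.
Qed.

(** A left derivative picks up signs only from what stands to the left of its variable, so a
    different generator at the far right is untouched. *)
Lemma gderiv_mulr_gvar a b f : a != b ->
  gderiv a (f * gvar K b) = gderiv a f * gvar K b.
Proof.
move=> neab; elim/gvarM_ind: f => [|k f g IHf IHg|c f IHf].
- by rewrite mul1r gderiv1 mul0r -[gvar K b]mulr1 gderiv_gvarM (negPf neab)
    gderiv1 mulr0 scale0r subr0.
- by rewrite !(mulrDl, linearD, linearZ) /= -scalerAl linearZ /= IHf IHg scalerAl.
- by rewrite -mulrA !gderiv_gvarM IHf mulrBl scalerAl mulrA.
Qed.

(** A generator passes a pair with two sign changes, which cancel; so pairs are central. *)
Lemma gvar2_comm a b f : GRing.comm (gvar K a * gvar K b) f.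
Proof.
elim/gvarM_ind: f => [|k f g IHf IHg|c f IHf]; first exact: commr1.
  apply: commrD => //; rewrite /GRing.comm -scalerAr -scalerAl.
  by congr (_ *: _); apply: IHf.
apply: commrM => //; rewrite /GRing.comm -mulrA (gvar_anticomm K b c) mulrN.
by rewrite [in LHS]mulrA (gvar_anticomm K a c) mulNr opprK mulrA.
Qed.

(** The Berezin integral over one mode, in the order of [berezin]. Derivatives are grouped in pairs
    because a pair passes foreign factors without a sign. *)
Definition gderiv2 a b f := gderiv b (gderiv a f).

Fact gderiv2_is_linear a b : linear (gderiv2 a b).
Proof. by move=> k f g; rewrite /gderiv2 !linearP. Qed.
HB.instance Definition _ a b :=
  GRing.isLinear.Build K G G *:%R (gderiv2 a b) (gderiv2_is_linear a b).

(** The constants for a pair of derivatives, on either side of any cofactor [g]. Quantifying over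
    [g] makes the property stable under products. *)
Definition inert2 a b u := forall g,
  gderiv2 a b (u * g) = u * gderiv2 a b g
  /\ gderiv2 a b (g * u) = gderiv2 a b g * u.

Lemma inert2_gvar a b x : a != x -> b != x -> inert2 a b (gvar K x).
Proof.
move=> nax nbx g; split; last by rewrite /gderiv2 !gderiv_mulr_gvar.
rewrite /gderiv2 gderiv_gvarM (negPf nax) scale0r sub0r linearN /=.
by rewrite gderiv_gvarM (negPf nbx) scale0r sub0r opprK.
Qed.

Lemma inert2_1 a b : inert2 a b 1.
Proof. by move=> g; rewrite !mul1r !mulr1. Qed.

Lemma inert2M a b u w : inert2 a b u -> inert2 a b w -> inert2 a b (u * w).
Proof.
move=> iu iw g; split; first by rewrite -mulrA (proj1 (iu _)) (proj1 (iw _)) mulrA.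
by rewrite mulrA (proj2 (iw _)) (proj2 (iu _)) mulrA.
Qed.

Lemma inert2D a b u w : inert2 a b u -> inert2 a b w -> inert2 a b (u + w).
Proof.
move=> iu iw g; rewrite !mulrDl !mulrDr !linearD /=.
by rewrite !(proj1 (iu _)) !(proj1 (iw _)) !(proj2 (iu _)) !(proj2 (iw _)).
Qed.

Lemma inert2Z a b k u : inert2 a b u -> inert2 a b (k *: u).
Proof.
move=> iu g; rewrite -!scalerAl -!scalerAr !linearZ /=.
by rewrite (proj1 (iu _)) (proj2 (iu _)).
Qed.

Lemma inert2N a b u : inert2 a b u -> inert2 a b (- u).
Proof. by rewrite -scaleN1r; apply: inert2Z. Qed.

(** Each pair of derivatives passes the integrated factors on its left and the remaining ones on its
    right, and acts on its own factor alone. *)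
Lemma foldl_gderiv2_prod (I : eqType) (a b : I -> 'I_N) (F : I -> G) (s : seq I) :
    uniq s ->
    (forall i k, i != k -> inert2 (a i) (b i) (F k)) ->
    (forall i k, i != k -> inert2 (a i) (b i) (gderiv2 (a k) (b k) (F k))) ->
  foldl (fun g i => gderiv2 (a i) (b i) g) (\prod_(i <- s) F i) s
  = \prod_(i <- s) gderiv2 (a i) (b i) (F i).
Proof.
(* The prefix [u] collects the factors already integrated, which stay inert for the pairs still to
   come. *)
move=> us iF iF'; suff gen u : (forall i, i \in s -> inert2 (a i) (b i) u) ->
    foldl (fun g i => gderiv2 (a i) (b i) g) (u * \prod_(i <- s) F i) s
    = u * \prod_(i <- s) gderiv2 (a i) (b i) (F i).
  by rewrite -[\prod_(i <- s) F i]mul1r gen ?mul1r // => i _; apply: inert2_1.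
elim: s u us => [|x s IHs] u /=; first by rewrite !big_nil.
move=> /andP[xs us] iu.
rewrite !big_cons (proj1 (iu _ (mem_head _ _) _)).
have inx : inert2 (a x) (b x) (\prod_(i <- s) F i).
  rewrite big_seq; elim/big_rec: _ => [|i g si IHg]; first exact: inert2_1.
  by apply: inert2M => //; apply: iF; apply: contraNneq xs => ->.
rewrite (proj2 (inx _)) mulrA IHs // ?mulrA // => i si.
apply: inert2M; first by apply: iu; rewrite inE si orbT.
by apply: iF'; apply: contraNneq xs => <-.
Qed.

Lemma berezin_prod n (v : 'I_n.*2 -> 'I_N) (F : 'I_n -> G) :
    (forall i k, i != k -> inert2 (v (ord_fst i)) (v (ord_snd i)) (F k)) ->
    (forall i k, i != k -> inert2 (v (ord_fst i)) (v (ord_snd i))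
       (gderiv2 (v (ord_fst k)) (v (ord_snd k)) (F k))) ->
  berezin v (\prod_m F m)
  = \prod_m gderiv2 (v (ord_fst m)) (v (ord_snd m)) (F m).
Proof.
move=> iF iF'; rewrite !big_enumT -(foldl_gderiv2_prod _ iF iF') ?enum_uniq //.
rewrite /berezin enum_double; elim: (enum 'I_n) (\prod_(_ <- _) _) => //=.
Qed.

Fact berezin_is_linear m (v : 'I_m -> 'I_N) : linear (@berezin K N m v).
Proof.
move=> k f g; rewrite /berezin; elim: (enum _) f g => //= i s IHs f g.
by rewrite linearP IHs.
Qed.
HB.instance Definition _ m (v : 'I_m -> 'I_N) :=
  GRing.isLinear.Build K G G *:%R (@berezin K N m v) (berezin_is_linear v).

End Calculus.

(** * The Fourier integral over one mode *)

Section PairIntegrals.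
Variables (C : numClosedFieldType) (N : nat) (a b : 'I_N).
Hypothesis neab : a != b.
Local Notation ga := (gvar C a).
Local Notation gb := (gvar C b).
Local Notation D := (@gderiv2 C N a b).

Lemma gderiv2_1 : D 1 = 0.
Proof. by rewrite /gderiv2 gderiv1 linear0. Qed.

Lemma gderiv2_fst : D ga = 0.
Proof.
rewrite /gderiv2 -[ga]mulr1 gderiv_gvarM gderiv1 mulr0 subr0 linearZ /=.
by rewrite gderiv1 scaler0.
Qed.

Lemma gderiv2_snd : D gb = 0.
Proof.
by rewrite /gderiv2 -[gb]mulr1 gderiv_gvarM (negPf neab) gderiv1 mulr0 scale0r
  subr0 linear0.
Qed.

Lemma gderiv2_pair : D (ga * gb) = 1.
Proof.
rewrite /gderiv2 gderiv_mulr_gvar // -[ga]mulr1 gderiv_gvarM eqxx gderiv1 mulr0.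
by rewrite subr0 scale1r mul1r -[gb]mulr1 gderiv_gvarM eqxx gderiv1 mulr0 subr0
  scale1r.
Qed.

Variables x y : 'I_N.
Hypotheses (ix : inert2 a b (gvar C x)) (iy : inert2 a b (gvar C y)).
Local Notation gx := (gvar C x).
Local Notation gy := (gvar C y).
(** The Fourier kernel of one mode, the exponential of ['i *: (gx * ga + gy * gb)]. *)
Let E := (1 + 'i *: (gx * ga)) * (1 + 'i *: (gy * gb)).

Let EE : E = 1 + 'i *: (gx * ga) + 'i *: (gy * gb) + gx * (gy * (ga * gb)).
Proof.
rewrite /E mulrDl mul1r mulrDr mulr1 addrACA addrA; congr (_ + _).
(* The sign of ['i ^+ 2] cancels that of exchanging [gy] with [ga]. *)
rewrite -scalerAl -scalerAr scalerA -expr2 sqrCi scaleN1r -mulrA -mulrN.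
by congr (_ * _); rewrite !mulrA (gvar_anticomm C y a) mulNr.
Qed.

Let Ea : E * ga = ga - 'i *: (gy * (ga * gb)).
Proof.
rewrite EE !mulrDl mul1r -!scalerAl -!mulrA gvar_sqr (gvar_anticomm C b a).
rewrite !mulrN [ga * (ga * gb)]mulrA gvar_sqr mul0r.
by rewrite !(mulr0, mulrN, scaler0, oppr0, addr0) scalerN.
Qed.

Let Eb : E * gb = gb + 'i *: (gx * (ga * gb)).
Proof.
rewrite EE !mulrDl mul1r -!scalerAl -!mulrA gvar_sqr.
by rewrite !(mulr0, scaler0, addr0).
Qed.

Let Eab : E * (ga * gb) = ga * gb.
Proof.
rewrite mulrA Ea mulrBl -scalerAl -!mulrA gvar_sqr.
by rewrite !(mulr0, scaler0, subr0).
Qed.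

(** First entry of the Fourier table: the integral keeps the terms containing both [ga] and [gb],
    and so exchanges a monomial with its complement up to a phase. *)
Lemma gderiv2_fourier_1 : D E = gx * gy.
Proof.
rewrite EE !linearD !linearZ /= !(proj1 (ix _)) !(proj1 (iy _)).
rewrite gderiv2_1 gderiv2_fst gderiv2_snd gderiv2_pair.
by rewrite !(mulr0, scaler0, addr0, add0r, mulr1).
Qed.

Lemma gderiv2_fourier_fst : D (E * ga) = - ('i *: gy).
Proof.
rewrite Ea linearB linearZ /= !(proj1 (iy _)) gderiv2_fst gderiv2_pair.
by rewrite mulr1 sub0r.
Qed.

Lemma gderiv2_fourier_snd : D (E * gb) = 'i *: gx.
Proof.
rewrite Eb linearD linearZ /= !(proj1 (ix _)) gderiv2_snd gderiv2_pair.
by rewrite mulr1 add0r.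
Qed.

Lemma gderiv2_fourier_pair : D (E * (ga * gb)) = 1.
Proof. by rewrite Eab gderiv2_pair. Qed.

End PairIntegrals.

(** * The Gaussian integral on monomials *)

Section GaussianIntegral.
Variables (C : numClosedFieldType) (n : nat).
Local Notation G := (grassmann C (n.*2 + n.*2 + n.*2)).
Implicit Types (m i j k : 'I_n) (S : {set 'I_n.*2}) (s : C).

(** A single term, not a general quadratic form: such a term is central and squares to zero, so
    exponentials of sums split into factors [1 + z]. *)
Definition quadratic N (z : grassmann C N) :=
  exists c x y, z = c *: (gvar C x * gvar C y).

Lemma quadraticZ N c x y : quadratic (c *: (gvar C x * gvar C y : grassmann C N)).
Proof. by exists c, x, y. Qed.

Lemma quadratic_comm N (z f : grassmann C N) : quadratic z -> GRing.comm z f.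
Proof.
move=> [c [x [y ->]]]; rewrite /GRing.comm -scalerAl -scalerAr.
by congr (_ *: _); apply: gvar2_comm.
Qed.

Lemma quadratic_sqr N (z : grassmann C N) : quadratic z -> z * z = 0.
Proof.
move=> [c [x [y ->]]]; rewrite -scalerAl -scalerAr mulrA gvar2_comm !mulrA.
by rewrite gvar_sqr !mul0r !scaler0.
Qed.

Lemma gexp_sum_quadratic N (zs : seq (grassmann C N)) :
    (forall z, z \in zs -> quadratic z) -> (size zs <= N)%N ->
  gexp (\sum_(z <- zs) z) = \prod_(z <- zs) (1 + z).
Proof.
move=> qzs szs; apply: (exp_trunc_sum (M := N)) => // [z|y z] zzs.
  exact/quadratic_sqr/qzs.
by move=> _; apply/quadratic_comm/qzs.
Qed.

Lemma add1_quadratic_comm N (z f : grassmann C N) :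
  quadratic z -> GRing.comm (1 + z) f.
Proof.
move=> qz; apply: commr_sym; apply: commrD; first exact: commr1.
exact/commr_sym/quadratic_comm.
Qed.

Definition modular_terms (j : 'I_n) s m : seq G :=
  (if m == j then [:: ('i * s) *: (theta (ord_fst m) * theta (ord_snd m));
                      (- ('i * s)) *: (eta (ord_fst m) * eta (ord_snd m))]
   else [:: 'i *: (theta (ord_fst m) * eta (ord_fst m));
            'i *: (theta (ord_snd m) * eta (ord_snd m))])
  ++ [:: 'i *: (eta (ord_fst m) * mu (ord_fst m));
         'i *: (eta (ord_snd m) * mu (ord_snd m))].

Lemma quadratic_modular_terms j s m z :
  z \in modular_terms j s m -> quadratic z.
Proof.
have mem2 (u v : G) : quadratic u -> quadratic v ->
    z \in [:: u; v] -> quadratic z.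
  by move=> qu qv; rewrite !inE => /orP[]/eqP->.
rewrite mem_cat; case: ifP => _ /orP[]; apply: mem2; exact: quadraticZ.
Qed.

(** The action of the theorem with a scalar [s] in place of the sign [(-1) ^+ eps]. *)
Definition occupation_action (j : 'I_n) s : G :=
  'i *: (s *: (theta (ord_fst j) * theta (ord_snd j)
               - eta (ord_fst j) * eta (ord_snd j)))
  + 'i *: \sum_(k | (k != ord_fst j) && (k != ord_snd j)) theta k * eta k.

Lemma sum_modular_terms j s :
  occupation_action j s + 'i *: (\sum_k eta k * mu k)
  = \sum_(m < n) \sum_(z <- modular_terms j s m) z.
Proof.
rewrite /modular_terms; under [RHS]eq_bigr => m _ do rewrite big_cat /=.
rewrite big_split /=; congr (_ + _); last first.
  rewrite sum_modes scaler_sumr; apply: eq_bigr => m _.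
  by rewrite big_cons big_seq1 scalerDr.
rewrite (bigD1 j) //= eqxx big_cons big_seq1 /occupation_action.
rewrite scalerA scalerBr scaleNr; congr (_ + _).
rewrite big_mkcond sum_modes (bigD1 j) //= !eqxx !eq_ord_mode !add0r.
rewrite scaler_sumr; apply: eq_bigr => m nemj.
by rewrite !eq_ord_mode (negPf nemj) /= big_cons big_seq1 scalerDr.
Qed.

Definition source_factor m : G :=
  (1 + 'i *: (eta (ord_fst m) * mu (ord_fst m)))
  * (1 + 'i *: (eta (ord_snd m) * mu (ord_snd m))).

Definition action_factor j s m : G :=
  if m == j then
    (1 + ('i * s) *: (theta (ord_fst m) * theta (ord_snd m)))
    * (1 - ('i * s) *: (eta (ord_fst m) * eta (ord_snd m)))
  else
    (1 + 'i *: (theta (ord_fst m) * eta (ord_fst m)))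
    * (1 + 'i *: (theta (ord_snd m) * eta (ord_snd m))).

Lemma gexp_occupation_action j s :
  gexp (occupation_action j s + 'i *: (\sum_k eta k * mu k))
  = \prod_(m < n) (action_factor j s m * source_factor m).
Proof.
rewrite sum_modular_terms.
have -> : \sum_(m < n) \sum_(z <- modular_terms j s m) z
    = \sum_(z <- flatten [seq modular_terms j s m | m <- enum 'I_n]) z.
  by rewrite big_flatten big_map [LHS]big_enumT.
rewrite gexp_sum_quadratic.
- rewrite big_flatten big_map -[LHS]big_enumT; apply: eq_bigr => m _.
  rewrite big_cat /action_factor /source_factor /=.
  have prod2 (u v : G) : \prod_(z <- [:: u; v]) (1 + z) = (1 + u) * (1 + v).
    by rewrite big_cons big_seq1.
  by case: ifP => _; rewrite !prod2 // scaleNr.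
- by move=> z /flatten_mapP[m _]; apply: quadratic_modular_terms.
(* Four terms per mode against six generators per mode: the truncation degree of [gexp] is large
   enough. *)
- rewrite size_flatten /shape -map_comp (@eq_map _ _ _ (fun=> 4%N)); last first.
    by move=> m; rewrite /= size_cat; case: ifP.
  rewrite sumnE big_map big_enum /= sum_nat_const card_ord.
  by rewrite -!muln2 -!mulnDr leq_mul.
Qed.

Lemma eq_eta_ord (k l : 'I_n.*2) : (eta_ord k == eta_ord l) = (k == l).
Proof. by rewrite !(eq_lshift, eq_rshift). Qed.

Lemma eq_mu_ord (k l : 'I_n.*2) : (mu_ord k == mu_ord l) = (k == l).
Proof. by rewrite !(eq_lshift, eq_rshift). Qed.

Lemma eta_theta_ord (k l : 'I_n.*2) : (eta_ord k == theta_ord l) = false.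
Proof. by rewrite eq_lshift eq_shift. Qed.

Lemma mu_theta_ord (k l : 'I_n.*2) : (mu_ord k == theta_ord l) = false.
Proof. by rewrite eq_shift. Qed.

Lemma mu_eta_ord (k l : 'I_n.*2) : (mu_ord k == eta_ord l) = false.
Proof. by rewrite eq_shift. Qed.

Definition eq_ordE := (eq_eta_ord, eq_mu_ord, eta_theta_ord,
  mu_theta_ord, mu_eta_ord, eq_ord_mode).

(** * The integrals over [mu] and [eta] in one mode *)

Definition fourier_mode S m : G :=
  if ord_fst m \in S then
    if ord_snd m \in S then 1 else - ('i *: eta (ord_snd m))
  else if ord_snd m \in S then 'i *: eta (ord_fst m)
  else eta (ord_fst m) * eta (ord_snd m).

(** For [s = (-1) ^+ eps], with [P] the projection and [x] the part of the Majorana monomial of [S]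
    in mode [j], this is the scalar [w] with [P * x * P = w *: P]. *)
Definition occupation_weight j s S : C :=
  if ord_fst j \in S then if ord_snd j \in S then - ('i * s) else 0
  else (ord_snd j \notin S)%:R.

Ltac inert_tac :=
  lazymatch goal with
  | |- inert2 _ _ (_ * _) => apply: inert2M; inert_tac
  | |- inert2 _ _ (_ + _) => apply: inert2D; inert_tac
  | |- inert2 _ _ (- _) => apply: inert2N; inert_tac
  | |- inert2 _ _ (_ *: _) => apply: inert2Z; inert_tac
  | |- inert2 _ _ 1 => exact: inert2_1
  | |- inert2 _ _ _ => apply: inert2_gvar; inert_tac
  | |- _ =>
      by rewrite !eq_ordE //;
         match goal with H : (_ == _) = false |- _ => rewrite H end
  end.

Lemma gderiv2_source_factor S m :
  gderiv2 (mu_ord (ord_fst m)) (mu_ord (ord_snd m))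
    (source_factor m * mode_prod mu S m) = fourier_mode S m.
Proof.
have ne : mu_ord (ord_fst m) != mu_ord (ord_snd m) by rewrite !eq_ordE.
rewrite /mode_prod /fourier_mode; case: ifP => _; case: ifP => _.
- by rewrite gderiv2_fourier_pair.
- by rewrite mulr1 gderiv2_fourier_fst //; inert_tac.
- by rewrite mul1r gderiv2_fourier_snd //; inert_tac.
- by rewrite !mulr1 gderiv2_fourier_1 //; inert_tac.
Qed.

(** Away from [j] the action is again a Fourier kernel. The second transform undoes the first, the
    phases ['i] and [- 'i] multiplying to one, and leaves [theta] in place of [mu]. *)
Lemma gderiv2_action_factor j s S m : m != j ->
  gderiv2 (eta_ord (ord_fst m)) (eta_ord (ord_snd m))
    (action_factor j s m * fourier_mode S m) = mode_prod theta S m.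
Proof.
have ne : eta_ord (ord_fst m) != eta_ord (ord_snd m) by rewrite !eq_ordE.
move=> /negPf nemj; rewrite /action_factor nemj /mode_prod /fourier_mode.
case: ifP => _; case: ifP => _.
- by rewrite mulr1 gderiv2_fourier_1 //; inert_tac.
- rewrite mulr1 mulrN -scalerAr linearN linearZ /= gderiv2_fourier_snd //;
    try by inert_tac.
  by rewrite scalerA -expr2 sqrCi scaleN1r opprK.
- rewrite mul1r -scalerAr linearZ /= gderiv2_fourier_fst //; try by inert_tac.
  by rewrite scalerN scalerA -expr2 sqrCi scaleN1r opprK.
- by rewrite !mulr1 gderiv2_fourier_pair.
Qed.

(** At [j] the [theta] factor is inert and comes out. The [eta] integral then kills odd monomials,
    and sends [1] to [- ('i * s)] and the full pair to [1]. *)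
Lemma gderiv2_action_factor_self j s S :
  gderiv2 (eta_ord (ord_fst j)) (eta_ord (ord_snd j))
    (action_factor j s j * fourier_mode S j)
  = occupation_weight j s S
    *: (1 + ('i * s) *: (theta (ord_fst j) * theta (ord_snd j))).
Proof.
have ne : eta_ord (ord_fst j) != eta_ord (ord_snd j) by rewrite !eq_ordE.
rewrite /action_factor eqxx -mulrA; set w := 1 + _.
have iw : inert2 (eta_ord (ord_fst j)) (eta_ord (ord_snd j)) w.
  by rewrite /w; inert_tac.
rewrite (proj1 (iw _)) mulrBl mul1r linearB -scalerAl linearZ /=.
rewrite /fourier_mode /occupation_weight; case: ifP => _; case: ifP => _ /=.
- rewrite !mulr1 gderiv2_1 gderiv2_pair // sub0r.
  by rewrite mulrN -scalerAr mulr1 scaleNr.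
- rewrite mulrN -scalerAr -mulrA gvar_sqr mulr0 !linearN !linearZ /=.
  rewrite gderiv2_snd // [gderiv2 _ _ 0]linear0.
  by rewrite !(oppr0, scaler0, addr0, mulr0) scale0r.
- rewrite -scalerAr (gvar2_comm _ _ (eta _)) mulrA gvar_sqr mul0r !linearZ /=.
  rewrite gderiv2_fst // [gderiv2 _ _ 0]linear0.
  by rewrite !(oppr0, scaler0, addr0, mulr0) scale0r.
- have q : quadratic (eta (ord_fst j) * eta (ord_snd j) : G).
    by rewrite -[_ * _]scale1r; apply: quadraticZ.
  rewrite (quadratic_sqr q) [gderiv2 _ _ 0]linear0 scaler0 subr0.
  by rewrite gderiv2_pair // mulr1 scale1r.
Qed.

Lemma inert2_mu_action_factor j s i k :
  inert2 (mu_ord (ord_fst i)) (mu_ord (ord_snd i)) (action_factor j s k).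
Proof. by rewrite /action_factor; case: ifP => _; inert_tac. Qed.

Lemma inert2_mu_source_factor i k : i != k ->
  inert2 (mu_ord (ord_fst i)) (mu_ord (ord_snd i)) (source_factor k).
Proof. by move=> /negPf neik; rewrite /source_factor; inert_tac. Qed.

Lemma inert2_mu_mode_prod S i k : i != k ->
  inert2 (mu_ord (ord_fst i)) (mu_ord (ord_snd i)) (mode_prod mu S k : G).
Proof.
by move=> /negPf neik; rewrite /mode_prod; case: ifP => _; case: ifP => _;
  inert_tac.
Qed.

Lemma inert2_mu_fourier_mode S i k :
  inert2 (mu_ord (ord_fst i)) (mu_ord (ord_snd i)) (fourier_mode S k).
Proof.
by rewrite /fourier_mode; case: ifP => _; case: ifP => _; inert_tac.
Qed.

Lemma inert2_eta_action_factor j s i k : i != k ->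
  inert2 (eta_ord (ord_fst i)) (eta_ord (ord_snd i)) (action_factor j s k).
Proof.
by move=> /negPf neik; rewrite /action_factor; case: ifP => _; inert_tac.
Qed.

Lemma inert2_eta_fourier_mode S i k : i != k ->
  inert2 (eta_ord (ord_fst i)) (eta_ord (ord_snd i)) (fourier_mode S k).
Proof.
by move=> /negPf neik; rewrite /fourier_mode; case: ifP => _; case: ifP => _;
  inert_tac.
Qed.

Lemma inert2_eta_mode_prod_theta S i k :
  inert2 (eta_ord (ord_fst i)) (eta_ord (ord_snd i)) (mode_prod theta S k : G).
Proof.
by rewrite /mode_prod; case: ifP => _; case: ifP => _; inert_tac.
Qed.

Lemma comm_action_source_factor j s m (f : G) :
  GRing.comm (action_factor j s m * source_factor m) f.
Proof.
apply: commr_sym; rewrite /action_factor /source_factor -scaleNr.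
by case: ifP => _; do 2!apply: commrM;
  apply/commr_sym/add1_quadratic_comm/quadraticZ.
Qed.

Lemma berezin_occupation_action j s S :
  berezin (@eta_ord n) (berezin (@mu_ord n)
    (gexp (occupation_action j s + 'i *: (\sum_k eta k * mu k))
     * \prod_(k in S) mu k))
  = occupation_weight j s S *: \prod_(m < n)
      (if m == j then 1 + ('i * s) *: (theta (ord_fst m) * theta (ord_snd m))
       else mode_prod theta S m).
Proof.
(* The exponential factors are central, so they can be interleaved with the parts of the monomial,
   mode by mode. *)
rewrite gexp_occupation_action prod_mode_prod -prodrM_comm => [|i k _ _].
  rewrite (eq_bigr (fun m => action_factor j s m
    * (source_factor m * mode_prod mu S m))) => [|m _]; last by rewrite mulrA.
  have step_mu k : gderiv2 (mu_ord (ord_fst k)) (mu_ord (ord_snd k))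
      (action_factor j s k * (source_factor k * mode_prod mu S k))
      = action_factor j s k * fourier_mode S k.
    by rewrite (proj1 (inert2_mu_action_factor _ _ _ _ _)) gderiv2_source_factor.
  rewrite berezin_prod => [|i k neik|i k neik]; last 2 first.
  - apply: inert2M; first exact: inert2_mu_action_factor.
    apply: inert2M; first exact: inert2_mu_source_factor.
    exact: inert2_mu_mode_prod.
  - rewrite step_mu; apply: inert2M; first exact: inert2_mu_action_factor.
    exact: inert2_mu_fourier_mode.
  under eq_bigr => k _ do rewrite step_mu.
  rewrite berezin_prod => [|i k neik|i k neik]; last 2 first.
  - apply: inert2M; first exact: inert2_eta_action_factor.
    exact: inert2_eta_fourier_mode.
  - have [->|nekj] := eqVneq k j; last first.
      by rewrite gderiv2_action_factor //; apply: inert2_eta_mode_prod_theta.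
    by rewrite gderiv2_action_factor_self; inert_tac.
  (* The weight is written as a product of scalars equal to [1] away from [j], so that it can be
     pulled out of the product over modes. *)
  rewrite (eq_bigr (fun m => (if m == j then occupation_weight j s S else 1)
      *: (if m == j then
            1 + ('i * s) *: (theta (ord_fst m) * theta (ord_snd m))
          else mode_prod theta S m))) => [|m _].
    by rewrite scaler_prod -big_mkcond big_pred1_eq.
  have [->|nemj] := eqVneq m j; first exact: gderiv2_action_factor_self.
  by rewrite scale1r gderiv2_action_factor.
exact: comm_action_source_factor.
Qed.

End GaussianIntegral.

(** * The Clifford algebra of the Majorana operators *)

Section Clifford.
Local Open Scope sesquilinear_scope.
Variables (C : numClosedFieldType) (n : nat) (a : 'I_n -> 'M[C]_(2 ^ n)).
Hypothesis ha : fermionic a.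
Local Notation M := 'M[C]_(2 ^ n).
Local Notation c := (majorana a).
Implicit Types (x y z : M) (k l : 'I_n.*2) (S T : {set 'I_n.*2}).

Lemma mx_scalerAr (t : C) x y : t *: (x * y) = x * (t *: y).
Proof. exact: scalemxAr. Qed.

Lemma mx_scalerAl (t : C) x y : t *: (x * y) = t *: x * y.
Proof. exact: scalemxAl. Qed.

Definition anticommutator x y : M := x * y + y * x.
Local Notation "{{ x , y }}" := (anticommutator x y).

Lemma anticommutatorC x y : {{x, y}} = {{y, x}}.
Proof. exact: addrC. Qed.

Lemma anticommutatorDl x y z : {{x + y, z}} = {{x, z}} + {{y, z}}.
Proof. by rewrite /anticommutator mulrDl mulrDr addrACA. Qed.

Lemma anticommutatorZl t x y : {{t *: x, y}} = t *: {{x, y}}.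
Proof. by rewrite /anticommutator scalerDr mx_scalerAl mx_scalerAr. Qed.

Lemma anticommutatorDr x y z : {{z, x + y}} = {{z, x}} + {{z, y}}.
Proof. by rewrite anticommutatorC anticommutatorDl ![{{_, z}}]anticommutatorC. Qed.

Lemma anticommutatorZr t x y : {{y, t *: x}} = t *: {{y, x}}.
Proof. by rewrite anticommutatorC anticommutatorZl anticommutatorC. Qed.

Lemma anticommutatorNl x y : {{- x, y}} = - {{x, y}}.
Proof. by rewrite -!scaleN1r anticommutatorZl. Qed.

Lemma anticommutatorNr x y : {{y, - x}} = - {{y, x}}.
Proof. by rewrite -!scaleN1r anticommutatorZr. Qed.

Lemma car_aa i j : {{a i, a j}} = 0.
Proof. exact: (proj1 (ha i j)). Qed.

Lemma car_ab i j : {{a i, (a j)^t*}} = (i == j)%:R *: (1 : M).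
Proof. exact: etrans (proj2 (ha i j)) (esym (scalemx1 _ _)). Qed.

Lemma car_ba i j : {{(a i)^t*, a j}} = (i == j)%:R *: (1 : M).
Proof. by rewrite anticommutatorC car_ab eq_sym. Qed.

Lemma car_bb i j : {{(a i)^t*, (a j)^t*}} = 0.
Proof.
have := congr1 (fun x => x^t*) (car_aa j i).
rewrite /anticommutator linearD /= map_mxD -!mulmxE !trmx_mul !map_mxM => ->.
by rewrite trmx0 map_mx0.
Qed.

Lemma ord_modeP k : k = ord_fst (mode k) \/ k = ord_snd (mode k).
Proof.
have := odd_double_half k; case: (odd k) => /= ek; [right|left];
  by apply: val_inj; rewrite /= -{1}ek.
Qed.

(** Bilinearity reduces the Clifford relations to the canonical anticommutation relations, in four
    cases by the parities of the two indices. *)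
Lemma majorana_anticommutator k l : {{c k, c l}} = (k == l)%:R *: (2%:R : M).
Proof.
have two (t : C) : t *: (1 : M) + t *: (1 : M) = t *: (2%:R : M).
  by rewrite -scalerDr.
have [->|->] := ord_modeP k; have [->|->] := ord_modeP l;
  rewrite ?majorana_fst ?majorana_snd !eq_ord_mode.
all: move: (mode k) (mode l) => i j.
all: rewrite ?(anticommutatorZl, anticommutatorZr) !anticommutatorDl.
all: rewrite !anticommutatorDr ?(anticommutatorNl, anticommutatorNr).
all: rewrite car_aa car_ab car_ba car_bb ?(oppr0, opprK, addr0, add0r).
- exact: two.
- by rewrite addrC subrr scaler0 scale0r.
- by rewrite addrC addNr scaler0 scale0r.
- by rewrite scalerA mulrNN -expr2 sqrCi scaleN1r -opprD opprK two.
Qed.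

Lemma majorana_sqr k : c k * c k = 1.
Proof.
have n2 : (2 : C) != 0 by rewrite pnatr_eq0.
apply: (scalerI n2); rewrite !scaler_nat mulr2n.
by have := majorana_anticommutator k k; rewrite eqxx scale1r.
Qed.

Lemma majorana_anticomm k l : k != l -> c k * c l = - (c l * c k).
Proof.
move=> /negPf nekl; apply/eqP; rewrite -addr_eq0.
by have := majorana_anticommutator k l; rewrite nekl scale0r => /eqP.
Qed.

(** * Trace orthogonality of the Majorana monomials *)

Definition clifford_monom S : M := \prod_(k in S) c k.

Definition commutation_sign S k : C := \prod_(l in S) (if l == k then 1 else -1).

Lemma majorana_monom k S :
  c k * clifford_monom S = commutation_sign S k *: (clifford_monom S * c k).
Proof.
rewrite /clifford_monom /commutation_sign; elim: (index_enum _) => [|l s IHs].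
  by rewrite !big_nil scale1r mulr1 mul1r.
rewrite !big_cons; case: ifP => // _.
have [->|nelk] := eqVneq l k.
  by rewrite mul1r -mulrA IHs -mx_scalerAr.
rewrite mulrA majorana_anticomm 1?eq_sym // mulN1r scaleNr mulNr.
by rewrite -!mulrA IHs -mx_scalerAr.
Qed.

Lemma commutation_signE S k : commutation_sign S k = (-1) ^+ #|S :\ k|.
Proof.
rewrite -prodr_const /commutation_sign [LHS]big_mkcond [RHS]big_mkcond.
by apply: eq_bigr => l _; rewrite !inE; case: (l \in S); case: (l == k).
Qed.

(* If [c k] commuted or anticommuted equally with the monomials of [S] and [T]
   for all [k], then [T] would be [S] or its complement; the parity of [n.*2]
   excludes the latter. *)
Lemma commutation_sign_neq S T : S != T ->
  exists k, commutation_sign S k * commutation_sign T k = -1.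
Proof.
move=> neST; suff /existsP[k]: [exists k, odd #|S :\ k| (+) odd #|T :\ k|].
  move=> oST; exists k; rewrite !commutation_signE -exprD -signr_odd oddD.
  by rewrite oST.
apply: contraNT neST => /existsPn evST; apply/eqP.
have inST k : (k \in S) (+) (k \in T) = odd #|S| (+) odd #|T|.
  have := evST k; rewrite (cardsD1 k S) (cardsD1 k T) !oddD !oddb.
  by case: (k \in S); case: (k \in T); case: (odd _); case: (odd _).
have [oST|/negPf eST] := boolP (odd #|S| (+) odd #|T|).
  have defT : T = ~: S.
    apply/setP => k; have := inST k; rewrite oST inE.
    by case: (k \in S); case: (k \in T).
  have := congr1 odd (cardsC S).
  by rewrite -defT oddD oST card_ord odd_double.
apply/setP => k; have := inST k; rewrite eST.
by case: (k \in S); case: (k \in T).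
Qed.

Lemma commutation_sign_sqr S k : commutation_sign S k * commutation_sign S k = 1.
Proof.
rewrite /commutation_sign -big_split /= big1 // => l _.
by case: ifP => _; rewrite ?mulr1 // mulrNN mulr1.
Qed.

Lemma clifford_monom_inv S :
  exists z, z * clifford_monom S = 1 /\ clifford_monom S * z = 1.
Proof.
rewrite /clifford_monom; elim/big_rec: _ => [|k y _ [z [zy yz]]].
  by exists 1; rewrite mulr1.
exists (z * c k); split; first by rewrite mulrA -(mulrA z) majorana_sqr mulr1.
by rewrite mulrA -(mulrA (c k)) yz mulr1 majorana_sqr.
Qed.

(** Conjugation by the involution [c k] preserves the trace and turns [x] into [- x]. *)
Lemma mxtrace_anticomm k x : c k * x = - (x * c k) -> \tr x = 0.
Proof.
move=> ckx; have : \tr x = - \tr x.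
  rewrite -{1}[x]mul1r -(majorana_sqr k) -mulrA ckx mulrN linearN /=.
  by rewrite -!mulmxE mulmxA mxtrace_mulC mulmxA mulmxE majorana_sqr mul1r.
move/eqP; rewrite -addr_eq0 -mulr2n -mulr_natl mulf_eq0 pnatr_eq0 /=.
by move/eqP.
Qed.

(** The inverse [z] commutes with [c k] up to the same sign as the monomial of [T]. For a [k] that
    separates [S] from [T], the product [z * clifford_monom S] therefore anticommutes with [c k]. *)
Lemma mxtrace_monom_inv S T z : S != T -> z * clifford_monom T = 1 ->
  clifford_monom T * z = 1 -> \tr (z * clifford_monom S) = 0.
Proof.
move=> /commutation_sign_neq[k sk] zT Tz; apply: (mxtrace_anticomm (k := k)).
have ckz : c k * z = commutation_sign T k *: (z * c k).
  have -> : z * c k = commutation_sign T k *: (c k * z).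
    rewrite -[LHS]mulr1 -Tz mulrA -(mulrA z) majorana_monom.
    by rewrite -mx_scalerAr -mx_scalerAl !mulrA zT mul1r.
  by rewrite scalerA commutation_sign_sqr scale1r.
rewrite mulrA ckz -mx_scalerAl -mulrA majorana_monom -mx_scalerAr scalerA mulrA.
by rewrite mulrC sk scaleN1r.
Qed.

(** The trace against the inverse of the monomial of [T] reads off [f T], multiplied by the nonzero
    dimension [2 ^ n]. *)
Lemma clifford_of_grassmann_inj f : clifford_of_grassmann a f = 0 -> f = 0.
Proof.
move=> f0; apply/ffunP => T; rewrite ffunE.
have [z [zT Tz]] := clifford_monom_inv T.
have := congr1 (fun y => \tr (z * y)) f0.
rewrite /clifford_of_grassmann mulr_sumr mulr0 linear0 linear_sum /=.
rewrite (bigD1 T) //= [X in _ + X]big1 => [|S neST]; last first.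
  by rewrite -mx_scalerAr linearZ /= (mxtrace_monom_inv neST) // mulr0.
rewrite addr0 -mx_scalerAr zT linearZ /= mxtrace1 => /eqP.
by rewrite mulf_eq0 pnatr_eq0 expn_eq0 /= orbF => /eqP.
Qed.

(** * The Grassmann representation as a linear isomorphism *)

Fact clifford_of_grassmann_is_linear : linear (clifford_of_grassmann a).
Proof.
move=> t f g; rewrite /clifford_of_grassmann scaler_sumr -big_split /=.
by apply: eq_bigr => S _; rewrite !ffunE scalerDl scalerA.
Qed.
HB.instance Definition _ := GRing.isLinear.Build C (grassmann C n.*2) M *:%R
  (clifford_of_grassmann a) clifford_of_grassmann_is_linear.

Let lker_clifford : lker (linfun (clifford_of_grassmann a)) == 0%VS.
Proof.
apply/lker0P => f g; rewrite !lfunE /= => efg.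
by apply/subr0_eq/clifford_of_grassmann_inj; rewrite linearB /= efg subrr.
Qed.

Lemma grassmann_repK : cancel (clifford_of_grassmann a) (grassmann_rep a).
Proof.
by move=> f; rewrite /grassmann_rep -[X in _^-1%VF X]lfunE /= lker0_lfunK.
Qed.

(** Injectivity suffices, as both spaces have dimension [2 ^ n.*2]. *)
Lemma clifford_of_grassmann_onto x : exists f, x = clifford_of_grassmann a f.
Proof.
exists (grassmann_rep a x); rewrite /grassmann_rep -[RHS]lfunE /= limg_lfunVK //.
suff -> : limg (linfun (clifford_of_grassmann a)) = fullv by rewrite memvf.
apply/eqP; rewrite eqEdim subvf /= limg_dim_eq; last first.
  by rewrite (eqP lker_clifford) capv0.
have cardS : #|{set 'I_n.*2}| = (2 ^ n.*2)%N.
  by rewrite -cardsT -powersetT card_powerset cardsT card_ord.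
have dimG : dim (grassmann C n.*2) = (2 ^ n.*2)%N.
  by rewrite -cardS -[RHS]muln1.
by rewrite !dimvf dimG -addnn expnD.
Qed.

End Clifford.

(** * The occupation maps *)

(** Isolates mode [j] in a non-commutative product: the same [l] and [r] serve for every entry [x],
    so products that differ only in that slot can be compared and combined. *)
Lemma prod_slot (A : pzSemiRingType) (I : finType) (F : I -> A) (j : I) :
  exists l r : A,
    (forall x, \prod_i (if i == j then x else F i) = l * x * r)
    /\ (forall y, (forall i, i != j -> GRing.comm y (F i)) ->
         GRing.comm y l /\ GRing.comm y r).
Proof.
have [s1 [s2 def_s]] : exists s1 s2, enum I = s1 ++ j :: s2.
  by have := mem_enum I j; case/splitPr => s1 s2; exists s1, s2.
have := enum_uniq I; rewrite def_s cat_uniq /= => /and3P[_ js1 /andP[js2 _]].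
rewrite negb_or in js1; case/andP: js1 => js1 _.
have slot x s : j \notin s ->
    \prod_(i <- s) (if i == j then x else F i) = \prod_(i <- s) F i.
  move=> js; apply: eq_big_seq => i si.
  by rewrite ifN //; apply: contraNneq js => <-.
exists (\prod_(i <- s1) F i), (\prod_(i <- s2) F i); split=> [x|y yF].
  by rewrite big_enumT def_s big_cat big_cons /= eqxx !slot // mulrA.
split; rewrite big_seq; apply: commr_prod => i si; apply: yF.
  by apply: contraNneq js1 => <-.
by apply: contraNneq js2 => <-.
Qed.

Section Occupation.
Local Open Scope sesquilinear_scope.
Variables (C : numClosedFieldType) (n : nat) (a : 'I_n -> 'M[C]_(2 ^ n)).
Hypothesis ha : fermionic a.
Local Notation M := 'M[C]_(2 ^ n).
Local Notation c := (majorana a).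
Local Notation G := (grassmann C (n.*2 + n.*2 + n.*2)).
Implicit Types (x y z : M) (k l : 'I_n.*2) (S T : {set 'I_n.*2}) (t : C).
Variable j : 'I_n.

Let q : M := c (ord_fst j) * c (ord_snd j).

(** The commutator of [a j] with its adjoint is ['i *: q], and their anticommutator is [1]; half the
    sum and half the difference are the two projections. *)
Lemma occupation_projE eps :
  occupation_proj a j eps = 2^-1 *: (1 + ('i * (-1) ^+ eps) *: q).
Proof.
have n2 : (2 : C) != 0 by rewrite pnatr_eq0.
have sqr0 x : anticommutator x x = 0 -> x * x = 0.
  by move=> xx0; apply: (scalerI n2); rewrite scaler_nat mulr2n scaler0.
have iq : 'i *: q = a j * (a j)^t* - (a j)^t* * a j.
  rewrite /q majorana_fst majorana_snd -mx_scalerAr scalerA mulrN -expr2 sqrCi.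
  rewrite opprK scale1r mulrDl !mulrBr (sqr0 _ (car_aa ha j j)).
  by rewrite (sqr0 _ (car_bb ha j j)) subr0 sub0r addrC.
have one_aa : (1 : M) = a j * (a j)^t* + (a j)^t* * a j.
  by have := car_ab ha j j; rewrite eqxx scale1r.
rewrite mulrC -scalerA iq {1}one_aa /occupation_proj; apply: (scalerI n2).
rewrite [RHS]scalerA mulfV // scale1r scaler_nat mulr2n.
case: eps; rewrite ?expr1 ?expr0 ?scale1r ?scaleN1r ?opprB.
  by rewrite addrCA -addrA subrKC.
by rewrite addrACA subrr addr0.
Qed.

(** * Compression of one mode by the projection *)

Section Sandwich.
Variable s : C.
Local Notation t := ('i * s).
Hypothesis t2 : t * t = -1.
Let E : M := 1 + t *: q.

Lemma majorana_pair_sqr : q * q = - 1.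
Proof.
rewrite /q mulrA -(mulrA _ _ (c (ord_fst j))).
rewrite (majorana_anticomm ha (k := ord_snd j)) ?eq_ord_mode //.
by rewrite mulrN mulNr mulrA majorana_sqr // mul1r majorana_sqr.
Qed.

Lemma pair_factor_sqr : E * E = 2 *: E.
Proof.
rewrite /E mulrDl mul1r mulrDr mulr1 -mx_scalerAl -mx_scalerAr scalerA t2.
rewrite majorana_pair_sqr scaleN1r opprK scalerDr !scaler_nat !mulr2n.
by rewrite [t *: q + 1]addrC addrACA.
Qed.

Lemma pair_factor_mulq : q * E = (- t) *: E.
Proof.
rewrite /E mulrDr mulr1 -mx_scalerAr majorana_pair_sqr scalerDr scalerA mulNr t2.
by rewrite opprK scale1r scalerN scaleNr addrC.
Qed.

(** Moving [x] to the left turns the first [E] into [1 - t *: q], which annihilates the second. *)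
Lemma pair_factor_odd x : x * q = - (q * x) -> E * x * E = 0.
Proof.
move=> xq; have -> : E * x = x * (1 - t *: q).
  by rewrite /E mulrDl mul1r mulrBr mulr1 -mx_scalerAl -mx_scalerAr xq scalerN opprK.
rewrite -mulrA mulrBl mul1r -mx_scalerAl pair_factor_mulq scalerA mulrN t2.
by rewrite opprK scale1r subrr mulr0.
Qed.

(** A lone Majorana operator of the mode anticommutes with [q] and is killed; the pair [q] acts on
    [E] as [- t]. The [2] arises because [E] is twice a projection. *)
Lemma pair_factor_mode S :
  E * mode_prod c S j * E = (2 * occupation_weight j s S) *: E.
Proof.
have anti : c (ord_snd j) * c (ord_fst j) = - (c (ord_fst j) * c (ord_snd j)).
  by rewrite majorana_anticomm ?eq_ord_mode.
rewrite /mode_prod /occupation_weight; case: ifP => _; case: ifP => _ /=.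
- rewrite -mulrA pair_factor_mulq -mx_scalerAr pair_factor_sqr scalerA.
  by rewrite mulrC.
- rewrite mulr1 mulr0 scale0r pair_factor_odd // /q.
  by rewrite -mulrA anti mulrN opprK.
- rewrite mul1r mulr0 scale0r pair_factor_odd // /q.
  by rewrite mulrA anti mulNr.
- by rewrite !mulr1 pair_factor_sqr.
Qed.

Lemma pair_factor_comm S m : m != j -> GRing.comm E (mode_prod c S m).
Proof.
move=> nemj.
have cq k : k != ord_fst j -> k != ord_snd j -> GRing.comm E (c k).
  move=> nekp nekq; apply: commr_sym; apply: commrD; first exact: commr1.
  rewrite /GRing.comm -mx_scalerAl -mx_scalerAr /q mulrA.
  rewrite (majorana_anticomm ha nekp) mulNr -!mulrA (majorana_anticomm ha nekq).
  by rewrite mulrN opprK.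
apply: commrM; case: ifP => _; try exact: commr1.
all: by apply: cq; rewrite eq_ord_mode.
Qed.
End Sandwich.

(** * Comparison of the two sides on monomials *)

Fact gsubst_is_linear (v : 'I_n.*2 -> G) : linear (gsubst v).
Proof.
move=> b f g; rewrite /gsubst scaler_sumr -big_split /=.
by apply: eq_bigr => S _; rewrite !ffunE scalerDl scalerA.
Qed.
HB.instance Definition _ (v : 'I_n.*2 -> G) :=
  GRing.isLinear.Build C (grassmann C n.*2) G *:%R (gsubst v)
    (gsubst_is_linear v).

(** The monomial of [S] with its part in mode [j] replaced by $1 + t\theta_p\theta_q$, where $p, q$
    are the indices of that mode. As a combination of basis monomials it is evaluated directly by
    both [clifford_of_grassmann] and [gsubst]. *)
Definition occupied_grassmann t S : grassmann C n.*2 :=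
  gmonom C (S :\ ord_fst j :\ ord_snd j)
  + t *: gmonom C (ord_fst j |: (ord_snd j |: S)).

Lemma prod_setD_mode (A : pzSemiRingType) (v : 'I_n.*2 -> A)
    (S : {set 'I_n.*2}) :
  \prod_(k in S :\ ord_fst j :\ ord_snd j) v k
  = \prod_(m < n) (if m == j then 1 else mode_prod v S m).
Proof.
rewrite prod_mode_prod; apply: eq_bigr => m _.
rewrite /mode_prod !inE !eq_ord_mode.
by have [->|] := eqVneq m j; rewrite //= mulr1.
Qed.

Lemma prod_setU_mode (A : pzSemiRingType) (v : 'I_n.*2 -> A)
    (S : {set 'I_n.*2}) :
  \prod_(k in ord_fst j |: (ord_snd j |: S)) v k
  = \prod_(m < n) (if m == j then v (ord_fst j) * v (ord_snd j)
                   else mode_prod v S m).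
Proof.
rewrite prod_mode_prod; apply: eq_bigr => m _.
rewrite /mode_prod !inE !eq_ord_mode.
by have [->|] := eqVneq m j.
Qed.

Lemma clifford_gmonom S :
  clifford_of_grassmann a (gmonom C S) = \prod_(k in S) c k.
Proof.
rewrite /clifford_of_grassmann (bigD1 S) //= [X in _ + X]big1 => [|T neT].
  by rewrite addr0 ffunE eqxx scale1r.
by rewrite ffunE (negPf neT) scale0r.
Qed.

Lemma gsubst_gmonom (v : 'I_n.*2 -> G) S :
  gsubst v (gmonom C S) = \prod_(k in S) v k.
Proof.
rewrite /gsubst (bigD1 S) //= [X in _ + X]big1 => [|T neT].
  by rewrite addr0 ffunE eqxx scale1r.
by rewrite ffunE (negPf neT) scale0r.
Qed.

Lemma occupation_map_gmonom eps S :
  occupation_map a j eps (clifford_of_grassmann a (gmonom C S))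
  = clifford_of_grassmann a
      ((occupation_weight j ((-1) ^+ eps) S / 2)
        *: occupied_grassmann ('i * (-1) ^+ eps) S).
Proof.
have t2 : 'i * (-1) ^+ eps * ('i * (-1) ^+ eps) = -1 :> C.
  by rewrite mulrACA -!expr2 sqrCi sqrr_sign mulr1.
rewrite linearZ linearD linearZ /= !clifford_gmonom.
rewrite prod_setD_mode prod_setU_mode.
rewrite /occupation_map !mulmxE occupation_projE prod_mode_prod.
rewrite -!mx_scalerAl -mx_scalerAr scalerA.
have [l [r [slot comm_slot]]] := prod_slot (mode_prod c S) j.
have [|cl cr] := comm_slot (1 + ('i * (-1) ^+ eps) *: q).
  by move=> m; apply: pair_factor_comm.
have -> : \prod_m mode_prod c S m = l * mode_prod c S j * r.
  by rewrite -slot; apply: eq_bigr => m _; case: eqP => // ->.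
set e := 1 + _ in cl cr *.
(* As [e] commutes with the other modes, both copies move next to the part in mode [j]. *)
have -> : e * (l * mode_prod c S j * r) * e = l * (e * mode_prod c S j * e) * r.
  by rewrite -!mulrA -cr !mulrA cl.
rewrite (pair_factor_mode t2) -mx_scalerAr -mx_scalerAl scalerA.
rewrite !slot; have -> : l * 1 * r + ('i * (-1) ^+ eps) *: (l * q * r) = l * e * r.
  by rewrite mx_scalerAl mx_scalerAr -mulrDl -mulrDr.
(* The two factors [2^-1] of the projections meet the [2] of [pair_factor_mode], leaving half the
   weight. *)
congr (_ *: _).
have n2 : (2 : C) != 0 by rewrite pnatr_eq0.
by rewrite mulrA mulfVK // mulrC.
Qed.

Lemma gsubst_occupied t S :
  gsubst theta (occupied_grassmann t S)
  = \prod_(m < n) (if m == j then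
                     1 + t *: (theta (ord_fst m) * theta (ord_snd m))
                   else mode_prod theta S m) :> G.
Proof.
have [l [r [slot _]]] := prod_slot (mode_prod (theta : _ -> G) S) j.
(* The entry is first written with [j] for [m], since the slot takes an entry independent of the
   index. *)
transitivity (\prod_(m < n) (if m == j then
    1 + t *: (theta (ord_fst j) * theta (ord_snd j)) else mode_prod theta S m) : G).
  rewrite linearD linearZ /= !gsubst_gmonom prod_setD_mode prod_setU_mode !slot.
  by rewrite scalerAl scalerAr -mulrDl -mulrDr.
by apply: eq_bigr => m _; case: eqP => [->|].
Qed.

Fact occupation_map_is_linear eps : linear (occupation_map a j eps).
Proof.
move=> t x y.
by rewrite /occupation_map mulmxDr mulmxDl -scalemxAr -scalemxAl.
Qed.

Lemma gaussian_integral_gmonom s S :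
  gaussian_integral a (occupation_action j s)
    (clifford_of_grassmann a (gmonom C S))
  = occupation_weight j s S *: gsubst theta (occupied_grassmann ('i * s) S).
Proof.
rewrite /gaussian_integral grassmann_repK // gsubst_gmonom.
by rewrite berezin_occupation_action gsubst_occupied.
Qed.

Fact grassmann_rep_is_linear : linear (grassmann_rep a).
Proof. exact: linearP. Qed.

Fact gaussian_integral_is_linear (Q : G) : linear (gaussian_integral a Q).
Proof.
move=> t x y; rewrite /gaussian_integral grassmann_rep_is_linear.
by rewrite linearP mulrDr -scalerAr !linearP.
Qed.

Lemma gsubst_occupation_map eps x :
  gsubst theta (grassmann_rep a (occupation_map a j eps x))
  = 2^-1 *: gaussian_integral a (occupation_action j ((-1) ^+ eps)) x.
Proof.
have [f ->] := clifford_of_grassmann_onto ha x.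
have lhs t y z : gsubst theta (grassmann_rep a (occupation_map a j eps (t *: y + z)))
    = t *: gsubst theta (grassmann_rep a (occupation_map a j eps y))
      + gsubst theta (grassmann_rep a (occupation_map a j eps z)) :> G.
  by rewrite occupation_map_is_linear grassmann_rep_is_linear linearP.
elim/gmonom_ind: f => [|t S g IHg].
  (* Both sides vanish at zero, by linearity at [-1 *: 0 + 0]. *)
  rewrite linear0; have := lhs (-1) 0 0.
  have := gaussian_integral_is_linear (occupation_action j ((-1) ^+ eps)) (-1) 0 0.
  by rewrite !(scaler0, addr0, scaleN1r, addNr) => -> ->; rewrite scaler0.
rewrite linearP lhs gaussian_integral_is_linear scalerDr IHg; congr (_ + _).
rewrite gaussian_integral_gmonom occupation_map_gmonom // grassmann_repK //.
rewrite linearZ /= !scalerA; congr (_ *: _).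
by rewrite mulrA [RHS]mulrC.
Qed.

(** * The action as a quadratic form with explicit matrices *)

Definition pair_mx : 'M[C]_n.*2 :=
  delta_mx (ord_fst j) (ord_snd j) - delta_mx (ord_snd j) (ord_fst j).

Lemma tr_pair_mx : pair_mx^T = - pair_mx.
Proof. by rewrite /pair_mx linearB /= !trmx_delta opprB. Qed.

Lemma bilinear_delta_mx p r (F : 'I_n.*2 -> 'I_n.*2 -> G) :
  \sum_k \sum_l (delta_mx p r : 'M[C]_n.*2) k l *: F k l = F p r.
Proof.
rewrite (bigD1 p) //= [X in _ + X]big1 ?addr0 => [|k /negPf nekp]; last first.
  by rewrite big1 // => l _; rewrite mxE nekp scale0r.
rewrite (bigD1 r) //= [X in _ + X]big1 ?addr0 => [|l /negPf nelr].
  by rewrite mxE !eqxx scale1r.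
by rewrite mxE nelr andbF scale0r.
Qed.

(** By anticommutation the two nonzero entries of the matrix contribute equally, which absorbs the
    denominator of ['i / 2]. *)
Lemma quadratic_form_pair_mx t (v : 'I_n.*2 -> G) :
    v (ord_snd j) * v (ord_fst j) = - (v (ord_fst j) * v (ord_snd j)) ->
  ('i / 2) *: (\sum_k \sum_l (t *: pair_mx) k l *: (v k * v l))
  = 'i *: (t *: (v (ord_fst j) * v (ord_snd j))).
Proof.
move=> anti; have n2 : (2 : C) != 0 by rewrite pnatr_eq0.
have -> : \sum_k \sum_l (t *: pair_mx) k l *: (v k * v l)
    = t *: (\sum_k \sum_l (delta_mx (ord_fst j) (ord_snd j) : 'M[C]_n.*2) k l
              *: (v k * v l)
            - \sum_k \sum_l (delta_mx (ord_snd j) (ord_fst j) : 'M[C]_n.*2) k l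
              *: (v k * v l)).
  rewrite -sumrB scaler_sumr; apply: eq_bigr => k _.
  rewrite -sumrB scaler_sumr; apply: eq_bigr => l _.
  by rewrite -scalerBl scalerA /pair_mx !mxE.
rewrite !bilinear_delta_mx anti opprK -mulr2n -scaler_nat !scalerA.
by congr (_ *: _); rewrite mulrAC divfK.
Qed.

(** Supplies the matrices of the Gaussian form: [A] and [D] are opposite multiples of [pair_mx], and
    [B] is the diagonal projection onto the other modes. *)
Lemma occupation_actionE s :
  occupation_action j s
  = quadratic_action (s *: pair_mx)
      (diag_mx (\row_k ((k != ord_fst j) && (k != ord_snd j))%:R))
      ((- s) *: pair_mx) :> G.
Proof.
rewrite /quadratic_action !quadratic_form_pair_mx;
  try exact: gvar_anticomm.
rewrite /occupation_action scalerBr scalerBr scaleNr scalerN addrAC.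
congr (_ + _ *: _ - _); rewrite big_mkcond; apply: eq_bigr => k _.
rewrite (bigD1 k) //= [X in _ + X]big1 ?addr0 => [|l nelk]; last first.
  by rewrite !mxE (eq_sym k l) (negPf nelk) scale0r.
by rewrite !mxE eqxx mulr1n; case: ifP; rewrite ?scale1r ?scale0r.
Qed.

Lemma gaussian_occupation_map eps : gaussian_map a (occupation_map a j eps).
Proof.
split; first exact: occupation_map_is_linear.
exists 2^-1, ((-1) ^+ eps *: pair_mx).
exists (diag_mx (\row_k ((k != ord_fst j) && (k != ord_snd j))%:R)).
exists ((- (-1) ^+ eps) *: pair_mx); split=> [||x].
- by rewrite linearZ /= tr_pair_mx scalerN.
- by rewrite linearZ /= tr_pair_mx scalerN.
- by rewrite gsubst_occupation_map occupation_actionE.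
Qed.

End Occupation.

Theorem mainTheorem5 (R : realType) (n : nat) (a : 'I_n -> 'M[R[i]]_(2 ^ n))
    (ha : fermionic a) (j : 'I_n) (eps : bool) :
  gaussian_map a (occupation_map a j eps) /\
  forall X : 'M[R[i]]_(2 ^ n),
    gsubst theta (grassmann_rep a (occupation_map a j eps X)) =
    2^-1 *: gaussian_integral a
      ('i *: ((-1) ^+ eps *: (theta (ord_fst j) * theta (ord_snd j)
                              - eta (ord_fst j) * eta (ord_snd j)))
       + 'i *: \sum_(k | (k != ord_fst j) && (k != ord_snd j)) theta k * eta k)
      X.
Proof.
split=> [|x]; first exact: gaussian_occupation_map.
exact: gsubst_occupation_map.
Qed.
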